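(* Let $\mathcal{H}$ be a complex Hilbert space and let $T\in\mathcal{L}(\mathcal{H})$ be a split operator. If $\|P_{T^*}(I-T^2)\|<1$, then the group proper splitting $T=T^\sharp-V$ converges. Conversely, if $P_{T^*}T^2$ is Hermitian and the group proper splitting of $T$ converges, then $\|P_{T^*}(I-T^2)\|<1$.
   Context: $T\in\mathcal{L}(\mathcal{H})$ is a split operator if it has closed range and $\mathcal{R}(T)\dotplus\mathcal{N}(T)=\mathcal{H}$ (direct sum). For such $T$, the group inverse $T^\sharp\in\mathcal{L}(\mathcal{H})$ is the unique operator $X$ with $TXT=T$, $XTX=X$, $TX=XT$. $P_{T^*}$ is the orthogonal projection onto $\mathcal{R}(T^* )$. A proper splitting of a closed range operator $T$ is a decomposition $T=U-V$ with $\mathcal{R}(U)=\mathcal{R}(T)$ and $\mathcal{N}(U)=\mathcal{N}(T)$; it converges if $\rho(U^\dagger V)<1$, where $\rho$ is the spectral radius and $U^\dagger$ the Moore-Penrose inverse. The group proper splitting of a split operator $T$ is $T=T^\sharp-V$, i.e. $V=T^\sharp-T$. *)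

(* Defs.v *)
From HB Require Import structures.
From mathcomp Require Import all_boot all_order all_algebra.
From mathcomp Require Import sesquilinear complex.
From mathcomp Require Import all_classical all_reals all_analysis.

Set Implicit Arguments.
Unset Strict Implicit.
Unset Printing Implicit Defensive.

Import Order.TTheory GRing.Theory Num.Theory.
Import numFieldNormedType.Exports.

Local Open Scope classical_set_scope.
Local Open Scope ring_scope.

(* The inner product is linear in its first argument and conjugate-linear in
   its second one. *)
HB.mixin Record CompleteNormedModule_isHilbert (R : realType) H
    of CompleteNormedModule R[i] H := {
  inner : {dot H for Num.conj};
  inner_norm : forall x : H, `|x| ^+ 2 = inner x x
}.

#[short(type="hilbertType")]
HB.structure Definition Hilbert (R : realType) :=
  {H of CompleteNormedModule R[i] H & CompleteNormedModule_isHilbert R H}.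

Arguments inner {R s}.

Section Operators.
Context {R : realType} {H : hilbertType R}.
Implicit Types (T U V X P : H -> H) (S : set H).

(* Norms on H take values in R[i]; they are brought back to R by Re. *)

Definition bounded_op T : Prop :=
  linear T /\ exists M : R, forall x, complex.Re `|T x| <= M * complex.Re `|x|.

Definition ker T : set H := T @^-1` [set 0].

Definition opnorm T : R :=
  sup [set complex.Re `|T x| | x in [set x : H | `|x| <= 1]].

Definition invertible_op T : Prop :=
  exists X, [/\ bounded_op X, T \o X = idfun & X \o T = idfun].

Definition spectrum T : set R[i] :=
  [set l | ~ invertible_op (fun x => T x - l *: x)].

(* sup set0 = 0, so the spectral radius is 0 when H is the null space. *)
Definition spectral_radius T : R :=
  sup [set complex.Re `|l| | l in spectrum T].

(* The objects below are introduced by definite description: [xget 0 A] is an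
   element of A whenever A is nonempty. *)

Definition adjoint T : H -> H :=
  xget 0 [set X | bounded_op X /\ forall x y, inner (T x) y = inner x (X y)].

Definition hermitian_op T : Prop := adjoint T = T.

Definition orth_proj S : H -> H :=
  xget 0 [set P | [/\ bounded_op P, P \o P = P, hermitian_op P & range P = S]].

Definition mp_inverse T : H -> H :=
  xget 0 [set X | [/\ bounded_op X, T \o X \o T = T, X \o T \o X = X,
                     hermitian_op (T \o X) & hermitian_op (X \o T)]].

Definition group_inverse T : H -> H :=
  xget 0 [set X | [/\ bounded_op X, T \o X \o T = T, X \o T \o X = X &
                     T \o X = X \o T]].

Definition split_op T : Prop :=
  [/\ bounded_op T, closed (range T),
      (forall x, exists u v, [/\ range T u, ker T v & x = u + v]) &
      range T `&` ker T = [set 0]].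

Definition proper_splitting T U V : Prop :=
  [/\ bounded_op U, bounded_op V, T = U \- V, range U = range T & ker U = ker T].

Definition converges T U V : Prop :=
  proper_splitting T U V /\ spectral_radius (mp_inverse U \o V) < 1.

Definition group_splitting_converges T : Prop :=
  converges T (group_inverse T) (group_inverse T \- T).

End Operators.

(* Main.v *)
(* Let P be the orthogonal projection onto N(T)^perp, which is the range of the
   adjoint of T, and X the group inverse of T, bounded by the closed graph
   theorem. The Moore-Penrose inverse of X is P T P_R(T), so the iteration
   operator mp_inverse X (X - T) is S := P (I - T^2). The splitting converges
   when ||S|| < 1, because the spectral radius is at most the norm. If P T^2 is
   Hermitian, then so is S; for such S, with a = ||S||, the inequality
   ||S^2 x - a^2 x||^2 <= a^2 (a^2 ||x||^2 - ||S x||^2) shows that S - a and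
   S + a cannot both be invertible, so the spectral radius equals the norm. *)

Require Import Defs.
From mathcomp Require Import all_boot all_order all_algebra.
From mathcomp Require Import sesquilinear complex.
From mathcomp Require Import all_classical all_reals all_analysis.
From mathcomp Require Import ring lra.

Set Implicit Arguments.
Unset Strict Implicit.
Unset Printing Implicit Defensive.

Import Order.TTheory GRing.Theory Num.Theory.
Import numFieldNormedType.Exports.

Local Open Scope classical_set_scope.
Local Open Scope complex_scope.
Local Open Scope ring_scope.

(** * Real-valued norms, the Cauchy-Schwarz inequality and geometric convergence *)

Section Norm.
Context {R : realType} {H : hilbertType R}.
Implicit Types (x y z : H) (a b : R[i]).

(** Norms and moduli take values in [R[i]]; these real versions put estimates in the ordered field
    [R]. [ri] is the real inner product underlying the complex one. *)
Definition nrm x : R := complex.Re `|x|.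
Definition cabs a : R := complex.Re `|a|.
Definition ri x y : R := complex.Re (inner x y).

Lemma normE x : `|x| = (nrm x)%:C.
Proof. by rewrite /nrm RRe_real // normr_real. Qed.

Lemma cabsE a : `|a| = (cabs a)%:C.
Proof. by rewrite /cabs RRe_real // normr_real. Qed.

Lemma ReD a b : complex.Re (a + b) = complex.Re a + complex.Re b.
Proof. by case: a b => [? ?] []. Qed.

Lemma ReN a : complex.Re (- a) = - complex.Re a.
Proof. by case: a. Qed.

Lemma ReZ (r : R) b : complex.Re (r%:C * b) = r * complex.Re b.
Proof. by case: b => ? ? /=; rewrite mul0r subr0. Qed.

Lemma nrm_ge0 x : 0 <= nrm x.
Proof. by rewrite -ler0c -normE. Qed.

Lemma nrm0 : nrm 0 = 0.
Proof. by rewrite /nrm normr0. Qed.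

Lemma nrm_eq0 x : nrm x = 0 -> x = 0.
Proof. by move=> h; apply/eqP; rewrite -normr_eq0 normE h. Qed.

Lemma nrmD x y : nrm (x + y) <= nrm x + nrm y.
Proof. by rewrite -lecR rmorphD /= -!normE ler_normD. Qed.

Lemma nrmZ a x : nrm (a *: x) = cabs a * nrm x.
Proof. by apply: complexI; rewrite rmorphM /= -normE normrZ cabsE normE. Qed.

Lemma nrmN x : nrm (- x) = nrm x.
Proof. by rewrite /nrm normrN. Qed.

Lemma nrm_distC x y : nrm (x - y) = nrm (y - x).
Proof. by rewrite -nrmN opprB. Qed.

Lemma nrmZr (r : R) x : nrm (r%:C *: x) = `|r| * nrm x.
Proof.
rewrite nrmZ /cabs; congr (_ * _).
by rewrite normc_def /= expr0n /= addr0 sqrtr_sqr.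
Qed.

Lemma nrm_tri y x z : nrm (x - z) <= nrm (x - y) + nrm (y - z).
Proof. by rewrite -[X in nrm X](subrKA y) nrmD. Qed.

Lemma innerDl x y z : inner (x + y) z = inner x z + inner y z.
Proof. exact: linearDl. Qed.
Lemma innerNl x z : inner (- x) z = - inner x z.
Proof. exact: linearNl. Qed.
Lemma innerBl x y z : inner (x - y) z = inner x z - inner y z.
Proof. by rewrite innerDl innerNl. Qed.
Lemma innerZl a x z : inner (a *: x) z = a * inner x z.
Proof. exact: linearZl_LR. Qed.
Lemma innerC x y : inner x y = (inner y x)^*%C.
Proof. by rewrite (hermC inner x y) /= expr0 mul1r. Qed.
Lemma inner0l z : inner 0 z = 0 :> R[i].
Proof. by have := innerZl 0 0 z; rewrite scale0r mul0r. Qed.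
Lemma inner0r z : inner z 0 = 0 :> R[i].
Proof. by rewrite innerC inner0l conjc0. Qed.
Lemma innerDr x y z : inner z (x + y) = inner z x + inner z y.
Proof. by rewrite innerC innerDl rmorphD /= -!innerC. Qed.
Lemma innerNr x z : inner z (- x) = - inner z x.
Proof. by rewrite innerC innerNl rmorphN /= -!innerC. Qed.
Lemma innerBr x y z : inner z (x - y) = inner z x - inner z y.
Proof. by rewrite innerDr innerNr. Qed.
Lemma innerZr a x z : inner z (a *: x) = a^*%C * inner z x.
Proof. by rewrite innerC innerZl rmorphM /= -!innerC. Qed.

Lemma riC x y : ri x y = ri y x.
Proof. by rewrite /ri innerC; case: (inner y x). Qed.

Lemma nrm2 x : nrm x ^+ 2 = ri x x.
Proof. by rewrite /ri -inner_norm normE -rmorphXn. Qed.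

Lemma inner_eq0 x : inner x x = 0 -> x = 0.
Proof.
move=> h; apply: nrm_eq0; apply/eqP.
by rewrite -sqrf_eq0 nrm2 /ri h.
Qed.

Lemma nrm2B x y : nrm (x - y) ^+ 2 = nrm x ^+ 2 - 2 * ri x y + nrm y ^+ 2.
Proof.
rewrite !nrm2 /ri innerBl !innerBr !ReD !ReN !ReD !ReN.
have := riC x y; rewrite /ri => ->; ring.
Qed.

Lemma nrm2D x y : nrm (x + y) ^+ 2 = nrm x ^+ 2 + 2 * ri x y + nrm y ^+ 2.
Proof.
have := nrm2B x (- y); rewrite opprK => ->; rewrite nrmN /ri innerNr ReN; ring.
Qed.

Lemma parallelogram x y :
  nrm (x + y) ^+ 2 + nrm (x - y) ^+ 2 = 2 * (nrm x ^+ 2 + nrm y ^+ 2).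
Proof. rewrite nrm2D nrm2B; ring. Qed.

Lemma riZl (r : R) x y : ri (r%:C *: x) y = r * ri x y.
Proof. by rewrite /ri innerZl ReZ. Qed.

(** Cauchy-Schwarz for the real part: with s = ||x|| and t = ||y||, expanding 0 <= ||t x - s y||^2
    gives 2 s t (s t - [ri x y]) >= 0. *)
Lemma ri_le x y : ri x y <= nrm x * nrm y.
Proof.
have [x0|x0] := eqVneq (nrm x) 0.
  by rewrite (nrm_eq0 x0) /ri inner0l nrm0 mul0r.
have [y0|y0] := eqVneq (nrm y) 0.
  by rewrite (nrm_eq0 y0) /ri inner0r nrm0 mulr0.
have px : 0 < nrm x by rewrite lt_neqAle eq_sym x0 nrm_ge0.
have py : 0 < nrm y by rewrite lt_neqAle eq_sym y0 nrm_ge0.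
have := sqr_ge0 (nrm ((nrm y)%:C *: x - (nrm x)%:C *: y)).
rewrite nrm2B !nrmZr !ger0_norm ?nrm_ge0 // riZl riC riZl riC !exprMn.
set s := nrm x; set t := nrm y => h.
have st : 0 < s * t by rewrite mulr_gt0.
rewrite -subr_ge0 -(pmulr_rge0 _ st); nra.
Qed.

Lemma cabs_inner x y : cabs (inner x y) <= nrm x * nrm y.
Proof.
set z := inner x y.
have [z0|z0] := eqVneq (cabs z) 0; first by rewrite z0 mulr_ge0 ?nrm_ge0.
have pz : 0 < cabs z.
  by rewrite lt_neqAle eq_sym z0 /= -ler0c -cabsE.
(* Multiplying x by the conjugate of z turns the inner product into the real number |z|^2, so the
   real inequality applies. *)
rewrite -(ler_pM2l pz); have := ri_le (z^*%C *: x) y.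
rewrite nrmZ -mulrA /ri innerZl -/z /cabs normcJ -/(cabs z); apply: le_trans.
rewrite (_ : _ * z = (cabs z ^+ 2)%:C) //.
by rewrite rmorphXn /= -cabsE sqr_normc mulrC.
Qed.

Lemma cabs_ge0 a : 0 <= cabs a.
Proof. by rewrite -ler0c -cabsE. Qed.

Lemma geometric_small (q C e : R) :
  0 <= q < 1 -> 0 < e -> exists n, C * q ^+ n < e.
Proof.
move=> /andP[q0 q1] e0.
have : (geometric C q n : R) @[n --> \oo] --> (0 : R).
  by apply: cvg_geometric; rewrite ger0_norm.
move=> /cvgrPdist_lt /(_ e e0)[N _ /(_ N (leqnn N))] /=.
rewrite sub0r normrN => hN; exists N; apply: le_lt_trans hN.
exact: ler_norm.
Qed.

(** The common use of completeness: Baire's theorem, the nearest point, the closed graph theorem and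
    the Neumann iteration all produce sequences with geometrically dominated increments. *)
Lemma geometric_cvg (x : nat -> H) (r : nat -> R) (q : R) :
  0 <= q < 1 -> (forall n, nrm (x n.+1 - x n) <= r n) ->
  (forall n, r n.+1 <= q * r n) ->
  exists l, forall n, nrm (l - x n) <= r n / (1 - q).
Proof.
move=> /andP[q0 q1] hx hr.
have q1' : 0 < 1 - q by rewrite subr_gt0.
have r0 n : 0 <= r n by apply: le_trans (hx n); exact: nrm_ge0.
(* Keeping the subtracted term lets the induction on m close: each increment is absorbed by the
   decrease of r / (1 - q). *)
have hd n m : nrm (x (n + m)%N - x n) <= r n / (1 - q) - r (n + m)%N / (1 - q).
  elim: m => [|m IH]; first by rewrite addn0 !subrr nrm0.
  rewrite addnS; apply: le_trans (nrm_tri (x (n + m)%N) _ _) _.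
  apply: le_trans (lerD (hx _) IH) _.
  have := hr (n + m)%N; rewrite -subr_ge0 => h.
  rewrite -subr_ge0.
  have -> : r n / (1 - q) - r (n + m).+1 / (1 - q)
     - (r (n + m)%N + (r n / (1 - q) - r (n + m)%N / (1 - q)))
     = (q * r (n + m)%N - r (n + m).+1) / (1 - q).
    by field; rewrite gt_eqF.
  by rewrite divr_ge0 // ltW.
have hd' n m : nrm (x (n + m)%N - x n) <= r n / (1 - q).
  by apply: le_trans (hd n m) _; rewrite gerBl divr_ge0 // ltW.
have hrn n : r n <= q ^+ n * r 0%N.
  elim: n => [|n IH]; first by rewrite expr0 mul1r.
  by apply: le_trans (hr n) _; rewrite exprS -mulrA ler_wpM2l.
have small e : 0 < e -> exists n, r n / (1 - q) < e.
  move=> e0; have [|n hn] := @geometric_small q (r 0%N / (1 - q)) e _ e0.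
    by rewrite q0.
  exists n; apply: le_lt_trans hn.
  by rewrite mulrAC ler_wpM2r ?invr_ge0 ?(ltW q1') // mulrC.
have : cvg (x n @[n --> \oo]).
  apply: cauchy_cvg; apply: cauchy_exP => e e0.
  have [|n hn] := small (complex.Re e).
    by move: e0; rewrite ltcE /= => /andP[].
  exists (x n); exists n => // m /= nm.
  (* In [R[i]] the hypothesis 0 < e forces a zero imaginary part, so the comparison is one of real
     parts. *)
  rewrite -ball_normE /= normE ltcE /=.
  have -> : complex.Im e = 0 by apply: ger0_Im; exact: ltW.
  rewrite eqxx /= nrm_distC; apply: le_lt_trans hn.
  by rewrite -(subnKC nm).
move=> /cvg_ex[l xl]; exists l => n.
apply/ler_addgt0Pr => e e0.
move: xl => /cvgrPdist_lt /(_ e%:C); rewrite ltcR => /(_ e0)[N _ hN].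
have := hN (n + N)%N (leq_addl _ _); rewrite /= normE ltcR => h.
apply: le_trans (nrm_tri (x (n + N)%N) _ _) _.
by rewrite addrC lerD // ltW.
Qed.

Lemma nrm_closed (A : set H) :
  (forall x, (forall e : R, 0 < e -> exists2 a, A a & nrm (x - a) < e) -> A x) ->
  closed A.
Proof.
move=> h x clx; apply: h => e e0.
have [|a [Aa /=]] := clx [set y | `|x - y| < e%:C].
  by apply/nbhs_normP; exists e%:C; rewrite /= ?ltcR.
by rewrite normE ltcR => xa; exists a.
Qed.

Lemma closed_nrm (A : set H) : closed A ->
  forall x, (forall e : R, 0 < e -> exists2 a, A a & nrm (x - a) < e) -> A x.
Proof.
move=> cA x h; apply: cA => B /nbhs_normP[e /= e0 eB].
have [|a Aa xa] := h (complex.Re e).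
  by move: e0; rewrite ltcE /= => /andP[].
exists a; split=> //; apply: eB; rewrite /= normE ltcE /=.
have -> : complex.Im e = 0 by apply: ger0_Im; exact: ltW.
by rewrite eqxx.
Qed.

End Norm.

(** * Baire's theorem and the closed graph theorem *)

Section ClosedGraph.
Context {R : realType} {H : hilbertType R}.
Implicit Types (x y z : H) (a b : R[i]) (T U X : H -> H) (A : set H).

Lemma linB T x y : linear T -> T (x - y) = T x - T y.
Proof.
by move=> h; rewrite [x - y]addrC -scaleN1r h scaleN1r addrC.
Qed.

Lemma lin0 T : linear T -> T 0 = 0.
Proof. by move=> h; have := linB 0 0 h; rewrite !subrr. Qed.

Lemma linZ T a x : linear T -> T (a *: x) = a *: T x.
Proof. by move=> h; have := h a x 0; rewrite (lin0 h) !addr0. Qed.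

Lemma linD T x y : linear T -> T (x + y) = T x + T y.
Proof. by move=> h; have := h 1 x y; rewrite !scale1r. Qed.

Lemma bounded_opP T : bounded_op T ->
  linear T /\ exists2 M : R, 0 < M & forall x, nrm (T x) <= M * nrm x.
Proof.
case=> lT [M hM]; split=> //; exists (`|M| + 1); first by rewrite ltr_wpDl.
move=> x; have hx : nrm (T x) <= M * nrm x := hM x.
apply: le_trans hx _; rewrite ler_wpM2r ?nrm_ge0 //.
by apply: le_trans (ler_norm M) _; rewrite lerDl.
Qed.

(** If every [F n] fails to be dense in every ball, shrinking balls can be chosen so that the n-th
    choice moves away from [F n]; their centres converge to a point in no [F n]. *)
Lemma Baire_cover (F : nat -> set H) : (forall x, exists n, F n x) ->
  exists n x0 (r : R), 0 < r /\ forall x, nrm (x - x0) < r ->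
    forall e : R, 0 < e -> exists2 y, F n y & nrm (x - y) < e.
Proof.
move=> cov; apply: contrapT => hn.
have step (u : nat * H * R) : exists v : H * R, 0 < u.2 ->
    [/\ nrm (v.1 - u.1.2) <= u.2, 0 < v.2, v.2 <= 2^-1 * u.2 &
       forall y, F u.1.1 y -> 2 * v.2 < nrm (v.1 - y)].
  case: u => -[n x0] r /=.
  have [r0|r0] := ltP 0 r; last by exists (0, 0).
  apply: contrapT => hv; apply: hn; exists n, x0, r; split=> // x xr e e0.
  (* [F n] misses the ball of radius e about x. The choice e / 3 keeps twice the new radius below e,
     and halving r makes the radii geometric. *)
  apply: contrapT => hy; apply: hv; exists (x, Num.min (2^-1 * r) (e / 3)) => _.
  split=> /=; first exact: ltW.
  - by rewrite lt_min !mulr_gt0.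
  - by rewrite ge_min lexx.
  move=> y Fy; apply: (@lt_le_trans _ _ e).
    have : Num.min (2^-1 * r) (e / 3) <= e / 3 by rewrite ge_min lexx orbT.
    by move: (Num.min _ _) => m hm; lra.
  by rewrite leNgt; apply/negP => hlt; apply: hy; exists y.
have [f hf] := choice step.
pose fix u n := if n is m.+1 then f (m, (u m).1, (u m).2) else (0 : H, 1 : R).
have u0 n : 0 < (u n).2.
  by elim: n => [|n IH] //=; case: (hf (n, (u n).1, (u n).2) IH).
have [|||l hl] := @geometric_cvg _ _ (fun n => (u n).1) (fun n => (u n).2) 2^-1.
- by apply/andP; split; lra.
- by move=> n; case: (hf (n, (u n).1, (u n).2) (u0 n)).
- by move=> n; case: (hf (n, (u n).1, (u n).2) (u0 n)).
have [n Fl] := cov l.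
(* With ratio 1/2 the limit lies within twice the radius of each centre, whereas [F n] is farther
   than that from centre n+1. *)
have [_ _ _ /(_ l Fl)] := hf (n, (u n).1, (u n).2) (u0 n).
have := hl n.+1; rewrite nrm_distC /=.
rewrite (_ : 1 - 2^-1 = 2^-1 :> R); last by lra.
by rewrite invrK mulrC => h1 h2; have := lt_le_trans h2 h1; rewrite ltxx.
Qed.

(* By Baire, the closure of some {x | ||X x|| <= n} contains a ball; correcting
   the error of an approximation repeatedly then bounds X, the closed graph
   identifying the limit. *)
Theorem closed_graph X : linear X ->
  (forall x y, (forall e : R, 0 < e ->
     exists x', nrm (x - x') < e /\ nrm (y - X x') < e) -> X x = y) ->
  bounded_op X.
Proof.
move=> lX gX.
have [x|n [x0 [r [r0 hr]]]] := @Baire_cover (fun n => [set x | nrm (X x) <= n%:R]).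
  by exists (Num.truncn (nrm (X x))).+1 => /=; apply/ltW/truncnS_gt.
(* A difference of two points with ||X y|| <= n has image of norm at most 2n; scaling z to norm r /
   2 costs a further factor 2 ||z|| / r. *)
pose C : R := 4 * n%:R / r.
have C0 : 0 <= C by rewrite !mulr_ge0 // invr_ge0 ltW.
have app1 z : nrm z < r -> forall e : R, 0 < e ->
    exists2 y, nrm (X y) <= 2 * n%:R & nrm (z - y) < e.
  move=> zr e e0; have e20 : 0 < e / 2 by rewrite divr_gt0.
  (* Approximating both x0 + z and x0 and subtracting moves the ball from x0 to the origin. *)
  have [|y1 /= Xy1 hy1] := hr (x0 + z) _ (e / 2) e20; first by rewrite addrC addKr.
  have [|y2 /= Xy2 hy2] := hr x0 _ (e / 2) e20; first by rewrite subrr nrm0.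
  exists (y1 - y2).
    rewrite linB //; apply: le_trans (nrmD _ _) _; rewrite nrmN; lra.
  have -> : z - (y1 - y2) = (x0 + z - y1) - (x0 - y2).
    rewrite -[x0 + z - y1]addrA !opprB [y2 - x0]addrC addrACA subrr add0r.
    by rewrite -addrA [- y1 + _]addrC.
  by apply: le_lt_trans (nrmD _ _) _; rewrite nrmN; lra.
have app2 (p : H * R) : exists y, 0 < p.2 ->
    nrm (X y) <= C * nrm p.1 /\ nrm (p.1 - y) < p.2.
  case: p => z e /=; have [e0|] := ltP 0 e; last by exists 0.
  have [z0|z0] := eqVneq (nrm z) 0.
    by exists 0; rewrite (lin0 lX) (nrm_eq0 z0) subrr nrm0 mulr0.
  have pz : 0 < nrm z by rewrite lt_neqAle eq_sym z0 nrm_ge0.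
  pose t := r / (2 * nrm z).
  have t0 : 0 < t by rewrite divr_gt0 // mulr_gt0.
  have tC : t%:C != 0 by rewrite (inj_eq (@complexI R)) gt_eqF.
  have [||y hy zy] := app1 (t%:C *: z) _ (t * e); last first.
  - exists ((t^-1)%:C *: y) => _; rewrite (linZ _ _ lX).
    rewrite nrmZr ger0_norm ?invr_ge0 ?(ltW t0) //.
    split.
      rewrite -(ler_pM2l t0) mulrA mulfV ?gt_eqF // mul1r.
      apply: le_trans hy _; rewrite le_eqVlt; apply/orP; left; apply/eqP.
      by rewrite /t /C; field; rewrite z0 gt_eqF.
    rewrite -(ltr_pM2l t0) -[X in X * nrm _](@ger0_norm _ t) ?ltW // -nrmZr.
    by rewrite scalerBr scalerA -rmorphM /= mulfV ?gt_eqF // scale1r.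
  - by rewrite mulr_gt0.
  - rewrite nrmZr ger0_norm ?ltW // /t.
    rewrite (_ : r / (2 * nrm z) * nrm z = r / 2); first by lra.
    by field.
have [Y hY] := choice app2.
split=> //; exists (2 * C) => z.
rewrite -![complex.Re `|_|]/(nrm _).
have [z0|z0] := eqVneq (nrm z) 0.
  by rewrite (nrm_eq0 z0) (lin0 lX) nrm0 mulr0.
have pz : 0 < nrm z by rewrite lt_neqAle eq_sym z0 nrm_ge0.
pose d n : R := nrm z * 2^-1 ^+ n.
have d0 k : 0 < d k by rewrite mulr_gt0 // exprn_gt0.
(* [u k] is the error left after k corrections, so z - [u k] is the sum of the corrections made so
   far. *)
pose fix u k := if k is m.+1 then u m - Y (u m, d m.+1) else z.
have hu k : nrm (u k) <= d k.
  case: k => [|k]; first by rewrite /d expr0 mulr1.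
  by have [_ /ltW] := hY (u k, d k.+1) (d0 _).
have half : 0 <= 2^-1 :> R by [].
have half1 : 2^-1 < 1 :> R by lra.
have [|||w hw] := @geometric_cvg _ _ (fun k => X (z - u k)) (fun k => C * d k) 2^-1.
- by rewrite half half1.
- move=> k; rewrite -linB //.
  have -> : z - u k.+1 - (z - u k) = Y (u k, d k.+1).
    by rewrite [- (z - u k)]opprB [LHS]addrC subrKA subKr.
  have [h _] := hY (u k, d k.+1) (d0 _).
  by apply: le_trans h _; rewrite ler_wpM2l //= hu.
- by move=> k; rewrite /d exprS [nrm z * _]mulrCA [leLHS]mulrCA lexx.
have -> : X z = w.
  apply: gX => e e0.
  (* The constant dominates both errors: ||z|| for z - [u k] against z, and 2 C ||z|| for its image
     against w. *)
  have [|k hk] := @geometric_small R 2^-1 (2 * C * nrm z + nrm z) e _ e0.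
    by rewrite half half1.
  have d2 : 0 < 2^-1 ^+ k :> R by rewrite exprn_gt0.
  exists (z - u k); rewrite subKr; split.
    apply: le_lt_trans (hu k) _; apply: le_lt_trans hk.
    by rewrite ler_wpM2r ?(ltW d2) // lerDr mulr_ge0 ?nrm_ge0 // mulr_ge0.
  have /= hwk := hw k; apply: le_lt_trans hwk _; apply: le_lt_trans hk.
  rewrite (_ : 1 - 2^-1 = 2^-1 :> R); last by lra.
  rewrite invrK /d mulrC !mulrA ler_wpM2r ?(ltW d2) //.
  by rewrite lerDl nrm_ge0.
have := hw 0%N; rewrite subrr (lin0 lX) subr0 /d expr0 mulr1.
rewrite (_ : 1 - 2^-1 = 2^-1 :> R); last by lra.
by rewrite invrK mulrC mulrA.
Qed.

End ClosedGraph.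

(** * Orthogonal projections, Riesz representation and adjoints *)

Section Projection.
Context {R : realType} {H : hilbertType R}.
Implicit Types (x y z : H) (a b : R[i]) (S T U X P : H -> H) (A : set H).

Definition closed_subspace A :=
  [/\ closed A, A 0 & forall a x y, A x -> A y -> A (a *: x + y)].

Definition perp A : set H := [set z | forall x, A x -> inner x z = 0].

Definition symmetric_op T := forall x y, inner (T x) y = inner x (T y).

Lemma subspaceB A x y : closed_subspace A -> A x -> A y -> A (x - y).
Proof.
case=> _ _ h Ax Ay; rewrite addrC -scaleN1r; exact: h.
Qed.

Lemma subspaceZ A a x : closed_subspace A -> A x -> A (a *: x).
Proof. by case=> _ A0 h Ax; rewrite -[_ *: _]addr0; apply: h. Qed.

Lemma subspaceD A x y : closed_subspace A -> A x -> A y -> A (x + y).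
Proof. by case=> _ _ h Ax Ay; rewrite -[x]scale1r; apply: h. Qed.

(** A minimizing sequence is Cauchy by the parallelogram law, since the midpoint of two of its terms
    is again in A and so is no closer to x than the infimum. *)
Lemma minimizer A x : closed_subspace A ->
  exists2 p, A p & forall y, A y -> nrm (x - p) <= nrm (x - y).
Proof.
move=> sA; have [cA A0 _] := sA.
pose E : set R := [set nrm (x - y) ^+ 2 | y in A].
have E0 : E !=set0 by exists (nrm (x - 0) ^+ 2); exists 0.
have lE : has_lbound E by exists 0 => _ [a _ <-]; exact: sqr_ge0.
have hE : has_inf E by [].
have half : 0 <= (2^-1 : R) < 1 by apply/andP; split; lra.
pose h n : R := 2^-1 ^+ n.
have h0 n : 0 < h n by rewrite exprn_gt0.
have hS n : h n.+1 = 2^-1 * h n by rewrite /h exprS.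
have approx (e : R) : 0 < e -> exists n, 4 * h n < e.
  by move=> e0; exact: geometric_small.
clearbody h.
(* The excess over the squared infimum is at most h^2, so consecutive terms differ by O(h): the
   parallelogram law gives 2 (1 + 1/4) h^2 <= (2 h)^2. *)
have pick n : exists y, A y /\ nrm (x - y) ^+ 2 < inf E + h n ^+ 2.
  have [|_ [a Aa <-] ?] := @inf_adherent _ E (h n ^+ 2) _ hE; last by exists a.
  by rewrite exprn_gt0.
have [a ha] := choice pick.
have lb y : A y -> inf E <= nrm (x - y) ^+ 2.
  by move=> Ay; apply: ge_inf => //; exists y.
have [|||p hp] := @geometric_cvg _ _ a (fun n => 2 * h n) 2^-1.
- exact: half.
- move=> n; have [An hn] := ha n; have [An' hn'] := ha n.+1.
  have := parallelogram (x - a n) (x - a n.+1).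
  have -> : x - a n - (x - a n.+1) = a n.+1 - a n.
    by rewrite [- (x - a n.+1)]opprB [LHS]addrC subrKA.
  have -> : x - a n + (x - a n.+1) = 2%:R%:C *: (x - (2^-1)%:C *: (a n + a n.+1)).
    rewrite scalerBr scalerA -rmorphM /= mulfV // scale1r.
    by rewrite rmorph_nat scaler_nat mulr2n addrACA opprD.
  rewrite nrmZr exprMn => hpar.
  have := lb _ (subspaceZ (2^-1)%:C sA (subspaceD sA An An')).
  have n2 : `|2%:R : R| = 2 by rewrite ger0_norm.
  rewrite hS in hn'; rewrite n2 in hpar => hlb.
  rewrite -(@ler_pXn2r _ 2) ?nnegrE ?nrm_ge0 ?mulr_ge0 ?(ltW (h0 n)) //.
  have := sqr_ge0 (h n); move: hn hn' hpar hlb; rewrite !exprMn; lra.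
- by move=> n; rewrite hS mulrCA.
have pa n : nrm (p - a n) <= 4 * h n.
  apply: le_trans (hp n) _; rewrite (_ : 1 - 2^-1 = 2^-1 :> R); last by lra.
  by rewrite invrK; have := h0 n; lra.
exists p.
  apply: (closed_nrm cA) => e e0; have [n hn] := approx e e0.
  by exists (a n); [case: (ha n)|apply: le_lt_trans (pa n) hn].
move=> b Ab; apply/ler_addgt0Pr => e e0.
have [|n hn] := approx (e / 2); first by rewrite divr_gt0.
apply: le_trans (nrm_tri (a n) _ _) _.
have [_ han] := ha n; have := lb b Ab => hb.
have hxa : nrm (x - a n) <= nrm (x - b) + h n.
  rewrite -(@ler_pXn2r _ 2) ?nnegrE ?addr_ge0 ?nrm_ge0 ?(ltW (h0 n)) //.
  have := mulr_ge0 (nrm_ge0 (x - b)) (ltW (h0 n)).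
  rewrite sqrrD; lra.
have := pa n; rewrite [nrm (p - _)]nrm_distC; have := h0 n; lra.
Qed.

Lemma projection_theorem A x : closed_subspace A ->
  exists2 p, A p & perp A (x - p).
Proof.
move=> sA; have [p Ap hp] := minimizer x sA; exists p => //.
have ri0 y : A y -> ri (x - p) y = 0.
  move=> Ay; have [y0|y0] := eqVneq (nrm y) 0.
    by rewrite (nrm_eq0 y0) /ri inner0r.
  have py : 0 < nrm y by rewrite lt_neqAle eq_sym y0 nrm_ge0.
  (* The real step along y that minimizes the distance to x; minimality of p makes the resulting
     gain vanish. *)
  pose t := ri (x - p) y / nrm y ^+ 2.
  have := hp _ (subspaceD sA Ap (subspaceZ t%:C sA Ay)).
  rewrite opprD addrA -(@ler_pXn2r _ 2) ?nnegrE ?nrm_ge0 //.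
  rewrite (nrm2B (x - p)) nrmZr exprMn real_normK ?num_real //.
  rewrite [ri _ (_ *: _)]riC riZl [ri y _]riC.
  have -> : 2 * (t * ri (x - p) y) = 2 * (ri (x - p) y ^+ 2 / nrm y ^+ 2).
    by rewrite /t; field.
  have -> : t ^+ 2 * nrm y ^+ 2 = ri (x - p) y ^+ 2 / nrm y ^+ 2.
    by rewrite /t; field.
  have : 0 <= ri (x - p) y ^+ 2 / nrm y ^+ 2 by rewrite divr_ge0 ?sqr_ge0.
  move=> h1 h2; have : ri (x - p) y ^+ 2 / nrm y ^+ 2 = 0 by lra.
  by move=> /eqP; rewrite mulf_eq0 invr_eq0 !sqrf_eq0 (negbTE y0) orbF => /eqP.
(* Applying the real orthogonality to a conjugate multiple of y makes the real part equal to the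
   squared modulus of the complex inner product. *)
move=> y Ay; have := ri0 _ (subspaceZ (inner y (x - p))^*%C sA Ay).
rewrite riC /ri innerZl mulrC -sqr_normc cabsE -rmorphXn /= => /eqP.
by rewrite sqrf_eq0 => /eqP h; apply/eqP; rewrite -normr_eq0 cabsE h.
Qed.

Lemma perp0 A x : A x -> perp A x -> x = 0.
Proof. by move=> Ax /(_ x Ax); exact: inner_eq0. Qed.

Lemma perpB A x y : perp A x -> perp A y -> perp A (x - y).
Proof. by move=> hx hy z Az; rewrite innerBr hx // hy // subrr. Qed.

Lemma projection_exists A : closed_subspace A ->
  exists P, [/\ bounded_op P, P \o P = P, symmetric_op P & range P = A].
Proof.
move=> sA; have [cA A0 lA] := sA.
have /choice[P hP] x : exists p, A p /\ perp A (x - p).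
  by have [p] := projection_theorem x sA; exists p.
(* This characterization of P x gives linearity and the identity on A; boundedness then comes from
   Pythagoras. *)
have uniq x y : A y -> perp A (x - y) -> P x = y.
  move=> Ay hy; have [APx hx] := hP x.
  apply/eqP; rewrite -subr_eq0; apply/eqP; apply: (@perp0 A).
    exact: subspaceB.
  have -> : P x - y = (x - y) - (x - P x).
    by rewrite [- (x - P x)]opprB [RHS]addrC subrKA.
  exact: perpB.
have PA y : A y -> P y = y.
  by move=> Ay; apply: uniq => //; rewrite subrr => z _; rewrite inner0r.
have orth x y : inner (P x) (y - P y) = 0.
  by have [_ h] := hP y; apply: h; case: (hP x).
have lP : linear P.
  move=> a x y; have [Ax hx] := hP x; have [Ay hy] := hP y.
  apply: uniq; first exact: lA.
  move=> z Az; rewrite opprD addrACA -scalerBr innerDr innerZr hx // hy //.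
  by rewrite mulr0 addr0.
exists P; split.
- split=> //; exists 1 => x; rewrite mul1r -![complex.Re `|_|]/(nrm _).
  rewrite -(@ler_pXn2r _ 2) ?nnegrE ?nrm_ge0 //.
  have := nrm2D (P x) (x - P x); rewrite addrC subrK => ->.
  by rewrite /ri orth /= mulr0 addr0 lerDl sqr_ge0.
- by apply/funext => x /=; apply: PA; case: (hP x).
- move=> x y; rewrite -[in LHS](subrK (P y) y) innerDr orth add0r.
  have : inner (x - P x) (P y) = 0 by rewrite innerC orth conjc0.
  by rewrite innerBl => /eqP; rewrite subr_eq0 => /eqP.
- apply/seteqP; split=> [_ [x _ <-]|x Ax]; first by case: (hP x).
  by exists x => //; apply: PA.
Qed.

Lemma adjoint_exists T : bounded_op T ->
  exists X, bounded_op X /\ forall x y, inner (T x) y = inner x (X y).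
Proof.
move=> bT; have [lT [M M0 hM]] := bounded_opP bT.
have /choice[X hX] y : exists z, forall x, inner (T x) y = inner x z.
  (* Riesz representation of x |-> <T x, y>: unless this functional vanishes, a vector u orthogonal
     to its kernel K represents it after scaling. *)
  pose K : set H := [set x | inner (T x) y = 0].
  have sK : closed_subspace K.
    split.
    - apply: nrm_closed => x hx; apply/eqP; rewrite -normr_eq0 cabsE.
      rewrite (_ : cabs _ = 0) //; apply/eqP.
      rewrite -(inj_eq (addrI 0)) !add0r eq_le cabs_ge0 andbT.
      apply/ler_addgt0Pr => e e0; rewrite add0r.
      (* The added 1 keeps the divisor positive when y = 0. *)
      have C0 : 0 < M * nrm y + 1 by rewrite ltr_wpDl // mulr_ge0 ?nrm_ge0 ?(ltW M0).
      have [|u /= Ku hu] := hx (e / (M * nrm y + 1)); first by rewrite divr_gt0.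
      have -> : inner (T x) y = inner (T (x - u)) y.
        by rewrite linB // innerBl Ku subr0.
      apply: le_trans (cabs_inner _ _) _.
      apply: (@le_trans _ _ ((M * nrm y + 1) * nrm (x - u))).
        have := ler_wpM2r (nrm_ge0 y) (hM (x - u)); have := nrm_ge0 (x - u); lra.
      by rewrite mulrC -ler_pdivlMr // ltW.
    - by rewrite /K /= lin0 // inner0l.
    - by move=> a u v; rewrite /K /= lT innerDl innerZl => -> ->; rewrite mulr0 addr0.
  have [K1|] := pselect (forall x, K x).
    by exists 0 => x; rewrite inner0r; apply: K1.
  move=> /existsNP[x0 Kx0]; have [p Kp hp] := projection_theorem x0 sK.
  set u := x0 - p in hp.
  have Ku : inner (T u) y != 0.
    by rewrite /u linB // innerBl Kp subr0; apply/eqP.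
  have u0 : inner u u != 0.
    by apply: contra Ku => /eqP/inner_eq0 ->; rewrite lin0 // inner0l.
  exists ((inner (T u) y / inner u u)^*%C *: u) => x.
  rewrite innerZr conjcK.
  (* Subtracting the right multiple of u from x lands in K, which is orthogonal to u. *)
  have : inner (x - (inner (T x) y / inner (T u) y) *: u) u = 0.
    by apply: hp; rewrite /K /= linB // linZ // innerBl innerZl divfK // subrr.
  rewrite innerBl innerZl => /eqP; rewrite subr_eq0 => /eqP ->.
  by field; rewrite Ku.
have uniq y z : (forall x, inner (T x) y = inner x z) -> X y = z.
  move=> h; apply/eqP; rewrite -subr_eq0; apply/eqP; apply: inner_eq0.
  by rewrite innerBr -hX h subrr.
exists X; split=> //; split.
  move=> a x y; apply: uniq => z.
  by rewrite !innerDr !innerZr -!hX.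
exists M => y; rewrite -![complex.Re `|_|]/(nrm _).
have [X0|X0] := eqVneq (nrm (X y)) 0.
  by rewrite X0 mulr_ge0 ?nrm_ge0 ?ltW.
have pX : 0 < nrm (X y) by rewrite lt_neqAle eq_sym X0 nrm_ge0.
(* ||X y||^2 = <T (X y), y> <= M ||X y|| ||y||, and ||X y|| cancels. *)
rewrite -(ler_pM2l pX) -expr2 nrm2 /ri -hX -/(ri _ _).
apply: le_trans (ri_le _ _) _; rewrite mulrA (mulrC (nrm (X y))).
by rewrite ler_wpM2r ?nrm_ge0.
Qed.

Lemma adjointP T : bounded_op T ->
  bounded_op (adjoint T) /\ forall x y, inner (T x) y = inner x (adjoint T y).
Proof.
move=> bT; have [X hX] := adjoint_exists bT.
exact: (xgetI 0 (P := [set X | bounded_op X /\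
  forall x y, inner (T x) y = inner x (X y)]) hX).
Qed.

Lemma hermitianP T : bounded_op T -> hermitian_op T <-> symmetric_op T.
Proof.
move=> bT; have [_ h] := adjointP bT; split=> [hT x y|hT].
  by rewrite h hT.
apply/funext => y; apply/eqP; rewrite -subr_eq0; apply/eqP; apply: inner_eq0.
by rewrite innerBr -h -hT subrr.
Qed.

Lemma orth_projP A : closed_subspace A ->
  [/\ bounded_op (orth_proj A), forall x, A (orth_proj A x),
      forall x, A x -> orth_proj A x = x,
      forall x, perp A (x - orth_proj A x) & symmetric_op (orth_proj A)].
Proof.
move=> sA; have [P [bP PP sP rP]] := projection_exists sA.
have : [set P | [/\ bounded_op P, P \o P = P, hermitian_op P & range P = A]] P.
  by split=> //; apply/hermitianP.
move=> /(xgetI 0); rewrite -/(orth_proj A).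
move: (orth_proj A) => Q [bQ QQ /(hermitianP bQ) sQ rQ].
have QA x : A x -> Q x = x.
  by rewrite -rQ => -[u _ <-]; exact: (congr1 (@^~ u) QQ).
split=> // [x|x u Au]; first by rewrite -rQ; exists x.
by rewrite innerBr -sQ QA // subrr.
Qed.

End Projection.

(** * Operator norm, spectrum and spectral radius *)

Section Spectrum.
Context {R : realType} {H : hilbertType R}.
Implicit Types (x y z : H) (a b l : R[i]) (S T U X P : H -> H).

Lemma bounded_op_id : bounded_op (idfun : H -> H).
Proof. by split=> //; exists 1 => x; rewrite mul1r. Qed.

Lemma bounded_op_comp T U : bounded_op T -> bounded_op U -> bounded_op (T \o U).
Proof.
move=> /bounded_opP[lT [M M0 hM]] /bounded_opP[lU [N N0 hN]]; split.
  by move=> a x y /=; rewrite lU lT.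
exists (M * N) => x; rewrite -![complex.Re `|_|]/(nrm _) -mulrA.
by apply: le_trans (hM _) _; rewrite ler_pM2l.
Qed.

Lemma bounded_opB T U : bounded_op T -> bounded_op U -> bounded_op (T \- U).
Proof.
move=> /bounded_opP[lT [M M0 hM]] /bounded_opP[lU [N N0 hN]]; split.
  by move=> a x y /=; rewrite lU lT scalerBr opprD addrACA.
exists (M + N) => x; rewrite -![complex.Re `|_|]/(nrm _) mulrDl.
by apply: le_trans (nrmD _ _) _; rewrite nrmN lerD.
Qed.

Lemma nrm_le1 x : (`|x| <= 1) = (nrm x <= 1).
Proof. by rewrite normE -lecR. Qed.

Lemma opnorm_le T (M : R) : linear T -> 0 <= M ->
  (forall x, nrm (T x) <= M * nrm x) -> opnorm T <= M.
Proof.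
move=> lT M0 hM; apply: ge_sup.
  by exists (nrm (T 0)); exists 0 => //=; rewrite normr0 ler01.
move=> _ [x /= x1 <-]; rewrite nrm_le1 in x1.
by apply: le_trans (hM x) _; rewrite ler_piMr.
Qed.

Lemma opnorm_has_ub T : bounded_op T ->
  has_ubound [set complex.Re `|T x| | x in [set x : H | `|x| <= 1]].
Proof.
move=> /bounded_opP[_ [M M0 hM]]; exists M => _ [y /= y1 <-].
rewrite nrm_le1 in y1; apply: le_trans (hM y) _.
by rewrite ler_piMr // ltW.
Qed.

Lemma nrm_opnorm T x : bounded_op T -> nrm (T x) <= opnorm T * nrm x.
Proof.
move=> bT; have [lT _] := bT.
have [x0|x0] := eqVneq (nrm x) 0.
  by rewrite (nrm_eq0 x0) (lin0 lT) nrm0 mulr0.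
have px : 0 < nrm x by rewrite lt_neqAle eq_sym x0 nrm_ge0.
rewrite -ler_pdivrMr // mulrC -[X in X * _](@ger0_norm _ (nrm x)^-1); last first.
  by rewrite invr_ge0 ltW.
rewrite -nrmZr -linZ //; apply: ub_le_sup.
  exact: opnorm_has_ub.
exists ((nrm x)^-1%:C *: x) => //=.
by rewrite nrm_le1 nrmZr ger0_norm ?invr_ge0 ?(ltW px) // mulVf.
Qed.

Lemma opnorm_ge0 T : bounded_op T -> 0 <= opnorm T.
Proof.
move=> bT; apply: ub_le_sup.
  exact: opnorm_has_ub.
exists 0; first by rewrite /= normr0 ler01.
by case: bT => lT _; rewrite lin0 // normr0.
Qed.

(** S x - l x = y is the fixed-point equation x = (S x - y) / l, a contraction of ratio ||S|| / |l|.
    Injectivity and the bound on the inverse both come from ||S x - l x|| >= (|l| - ||S||) ||x||. *)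
Lemma resolvent S l : bounded_op S -> opnorm S < cabs l ->
  invertible_op (fun x => S x - l *: x).
Proof.
move=> bS Ml; have [lS _] := bS; have M0 := opnorm_ge0 bS.
have hM x := nrm_opnorm x bS.
move: (opnorm S) M0 hM Ml => M M0 hM Ml.
have l0 : 0 < cabs l by apply: le_lt_trans Ml.
have nl0 : l != 0 by apply: contraTneq l0 => ->; rewrite /cabs normr0 ltxx.
have cV : cabs l^-1 = (cabs l)^-1.
  by apply: complexI; rewrite fmorphV /= -!cabsE normfV.
pose F x := S x - l *: x.
have FD x y : F (x - y) = F x - F y.
  by rewrite /F linB // scalerBr !opprD addrACA.
have below x : (cabs l - M) * nrm x <= nrm (F x).
  have h := nrmD (F x) (- S x); have hx := hM x.
  have e : F x - S x = - (l *: x) by rewrite /F addrAC subrr add0r.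
  rewrite e !nrmN nrmZ in h; lra.
have q01 : 0 <= M / cabs l < 1.
  by rewrite divr_ge0 ?(ltW l0) //= ltr_pdivrMr // mul1r.
have /choice[X hX] y : exists x, F x = y.
  pose fix u n := if n is m.+1 then l^-1 *: (S (u m) - y) else 0.
  pose q := M / cabs l; pose r n := nrm (u 1%N) * q ^+ n.
  have [||| x hx] := @geometric_cvg _ _ u r q.
  - exact: q01.
  - elim=> [|n IH]; first by rewrite /r expr0 mulr1 subr0.
    have -> : u n.+2 - u n.+1 = l^-1 *: S (u n.+1 - u n).
      by rewrite linB //= -scalerBr opprB addrA subrK.
    rewrite nrmZ cV mulrC ler_pdivrMr //; apply: le_trans (hM _) _.
    have -> : r n.+1 * cabs l = M * r n.
      by rewrite /r /q exprS; field; rewrite gt_eqF.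
    by rewrite ler_wpM2l.
  - by move=> n; rewrite /r exprS mulrCA.
  exists x; apply/eqP; rewrite -subr_eq0; apply/eqP/nrm_eq0/eqP.
  rewrite eq_le nrm_ge0 andbT; apply/ler_addgt0Pr => e e0; rewrite add0r.
  have q1 : 0 < 1 - q by rewrite subr_gt0; case/andP: q01.
  have [//|n hn] := @geometric_small R q (2 * M * nrm (u 1%N) / (1 - q)) e q01.
  (* Since l [u n.+1] = S ([u n]) - y, the residual of the limit is expressed by the errors of two
     consecutive iterates. *)
  have -> : F x - y = S (x - u n) + l *: (u n.+1 - x).
    rewrite linB //= scalerBr scalerA mulfV // scale1r /F.
    by rewrite -[S (u n) - y - _]addrA subrKA addrA addrAC.
  apply: le_trans (nrmD _ _) _; rewrite nrmZ nrm_distC.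
  have h1 : nrm (S (x - u n)) <= M * (r n / (1 - q)).
    by apply: le_trans (hM _) _; rewrite ler_wpM2l ?hx.
  have h2 : cabs l * nrm (x - u n.+1) <= M * (r n / (1 - q)).
    have -> : M * (r n / (1 - q)) = cabs l * (r n.+1 / (1 - q)).
      rewrite /r exprS -[X in X * _ = _](divfK (lt0r_neq0 l0)) -/q; ring.
    by rewrite ler_pM2l ?hx.
  have h3 : 2 * M * nrm (u 1%N) / (1 - q) * q ^+ n = 2 * (M * (r n / (1 - q))).
    by rewrite /r; ring.
  move: h1 h2; lra.
have inj x y : F x = F y -> x = y.
  move=> h; apply/eqP; rewrite -subr_eq0; apply/eqP/nrm_eq0/eqP.
  rewrite eq_le nrm_ge0 andbT -(@ler_pM2l _ (cabs l - M)) ?subr_gt0 // mulr0.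
  by apply: le_trans (below _) _; rewrite FD h subrr nrm0.
exists X; split.
- split.
    move=> a x y; apply: inj; rewrite hX.
    have -> : F (a *: X x + X y) = a *: F (X x) + F (X y).
      rewrite /F lS !scalerDr opprD addrACA scalerN !scalerA.
      by rewrite [l * a]mulrC.
    by rewrite !hX.
  exists (cabs l - M)^-1 => y; rewrite -![complex.Re `|_|]/(nrm _).
  rewrite -(@ler_pM2l _ (cabs l - M)) ?subr_gt0 //.
  rewrite mulrA mulfV ?gt_eqF ?subr_gt0 // mul1r -[X in _ <= nrm X]hX.
  exact: below.
- by apply/funext => y /=; exact: hX.
- by apply/funext => x /=; apply: inj; exact: hX.
Qed.

Lemma spectrum_opnorm S l : bounded_op S -> spectrum S l -> cabs l <= opnorm S.
Proof.
by move=> bS hl; rewrite leNgt; apply/negP => h; apply: hl; exact: resolvent.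
Qed.

Lemma spectrum_le S l : bounded_op S -> spectrum S l -> cabs l <= spectral_radius S.
Proof.
move=> bS hl; apply: ub_le_sup; last by exists l.
by exists (opnorm S) => _ [k hk <-]; exact: spectrum_opnorm.
Qed.

Lemma spectral_radius_ge0 S : bounded_op S -> 0 <= spectral_radius S.
Proof.
(* For an empty spectrum, the convention that [sup] of the empty set is 0 gives the bound. *)
move=> bS; have [|/set0P[l hl]] := eqVneq (spectrum S) set0.
  by rewrite /spectral_radius => ->; rewrite image_set0 sup0.
by apply: le_trans (spectrum_le bS hl); exact: cabs_ge0.
Qed.

Lemma spectral_radius_le_opnorm S : bounded_op S -> spectral_radius S <= opnorm S.
Proof.
move=> bS; have [|/set0P[l hl]] := eqVneq (spectrum S) set0.
  by rewrite /spectral_radius => ->; rewrite image_set0 sup0 opnorm_ge0.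
apply: ge_sup; first by exists (cabs l); exists l.
by move=> _ [k hk <-]; exact: spectrum_opnorm.
Qed.

Lemma symmetric_opnorm S : bounded_op S -> symmetric_op S ->
  opnorm S <= spectral_radius S.
Proof.
move=> bS sS; have [lS _] := bS.
have [a0|a0] := leP (opnorm S) 0.
  by apply: le_trans a0 _; exact: spectral_radius_ge0.
set a := opnorm S in a0 *.
have hS x : nrm (S x) <= a * nrm x by exact: nrm_opnorm.
have aC : cabs a%:C = a.
  by rewrite /cabs normc_def /= expr0n /= addr0 sqrtr_sqr ger0_norm // ltW.
have aCN : cabs (- a%:C) = a by rewrite -[RHS]aC /cabs normrN.
have [h|hp] := pselect (spectrum S a%:C).
  by rewrite -[leLHS]aC; exact: spectrum_le.
have [h|hm] := pselect (spectrum S (- a%:C)).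
  by rewrite -[leLHS]aCN; exact: spectrum_le.
exfalso.
have [X [/bounded_opP[_ [M M0 hM]] _ XS]] := contrapT hp.
have [Y [/bounded_opP[_ [N N0 hN]] _ YS]] := contrapT hm.
(* S^2 - a^2 = (S - a)(S + a) is bounded below: apply the inverse Y of S + a first, then the inverse
   X of S - a. *)
have low x : nrm x <= N * M * nrm (S (S x) - (a ^+ 2)%:C *: x).
  have := congr1 (@^~ x) YS => /= {1}<-.
  apply: le_trans (hN _) _; rewrite -mulrA ler_pM2l //.
  set y := S x - _; have := congr1 (@^~ y) XS => /= {1}<-.
  apply: le_trans (hM _) _; rewrite ler_pM2l //.
  rewrite le_eqVlt; apply/orP; left; apply/eqP; congr nrm.
  rewrite /y scaleNr opprK (linD _ _ lS) (linZ _ _ lS) scalerDr scalerA.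
  by rewrite -rmorphM /= -expr2 opprD addrA addrK.
have step x : nrm (S (S x) - (a ^+ 2)%:C *: x) ^+ 2 <=
    a ^+ 2 * (a ^+ 2 * nrm x ^+ 2 - nrm (S x) ^+ 2).
  rewrite nrm2B riC riZl nrmZr exprMn real_normK ?num_real //.
  (* Symmetry enters here: the cross term of the expansion becomes -2 a^2 ||S x||^2. *)
  have -> : ri x (S (S x)) = nrm (S x) ^+ 2 by rewrite nrm2 /ri sS.
  have : nrm (S (S x)) ^+ 2 <= a ^+ 2 * nrm (S x) ^+ 2.
    by rewrite -exprMn ler_pXn2r ?nnegrE ?mulr_ge0 ?nrm_ge0 ?(ltW a0).
  rewrite -exprM; lra.
pose C := (N * M * a) ^+ 2.
have C0 : 0 < C by rewrite exprn_gt0 // !mulr_gt0.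
(* [low] and [step] together give ||S x||^2 <= (a^2 - 1/C) ||x||^2, so b bounds S, although b < a =
   ||S||. *)
pose b := Num.sqrt (a ^+ 2 - C^-1).
have ba : b < a.
  rewrite -[ltRHS]ger0_norm ?(ltW a0) // -sqrtr_sqr ltr_sqrt ?exprn_gt0 //.
  by rewrite ltrBlDr ltrDl invr_gt0.
have : a <= b.
  apply: opnorm_le => // [|x]; first exact: sqrtr_ge0.
  rewrite -(@ler_pXn2r _ 2) ?nnegrE ?mulr_ge0 ?nrm_ge0 ?sqrtr_ge0 // exprMn.
  (* Only an inequality, because [Num.sqrt] is 0 at a negative argument. *)
  have hb : a ^+ 2 - C^-1 <= b ^+ 2.
    have [h|h] := leP 0 (a ^+ 2 - C^-1); first by rewrite sqr_sqrtr.
    by apply: le_trans (ltW h) _; exact: sqr_ge0.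
  apply: le_trans (ler_wpM2r (sqr_ge0 _) hb).
  have h : nrm x ^+ 2 <= C * (a ^+ 2 * nrm x ^+ 2 - nrm (S x) ^+ 2).
    have h1 : nrm x ^+ 2 <= (N * M * nrm (S (S x) - (a ^+ 2)%:C *: x)) ^+ 2.
      by rewrite ler_pXn2r ?nnegrE ?mulr_ge0 ?nrm_ge0 ?(ltW N0) ?(ltW M0).
    apply: le_trans h1 _; rewrite exprMn /C [(N * M * a) ^+ 2]exprMn
      -[_ * a ^+ 2 * _]mulrA.
    by rewrite ler_wpM2l ?sqr_ge0.
  rewrite mulrBl lerBrDr -lerBrDl ler_pdivrMl //.
by rewrite leNgt ba.
Qed.

End Spectrum.

(** * Existence of the group inverse and uniqueness of the Moore-Penrose inverse *)

Section Inverses.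
Context {R : realType} {H : hilbertType R}.
Implicit Types (x y z : H) (a b l : R[i]) (S T U X Y P : H -> H).

Lemma ker_closed_subspace T : bounded_op T -> closed_subspace (ker T).
Proof.
move=> /bounded_opP[lT [M M0 hM]]; split.
- apply: nrm_closed => x hx; apply: nrm_eq0; apply/eqP.
  rewrite eq_le nrm_ge0 andbT; apply/ler_addgt0Pr => e e0; rewrite add0r.
  have [|u Ku hu] := hx (e / M); first by rewrite divr_gt0.
  have -> : T x = T (x - u) by rewrite (linB _ _ lT) (Ku : T u = 0) subr0.
  by apply: le_trans (hM _) _; rewrite mulrC -ler_pdivlMr // ltW.
- by rewrite /ker /= lin0.
- by move=> a x y; rewrite /ker /= lT => -> ->; rewrite scaler0 addr0.
Qed.

Lemma range_closed_subspace T : linear T -> closed (range T) ->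
  closed_subspace (range T).
Proof.
move=> lT cT; split=> //; first by exists 0 => //; exact: lin0.
by move=> a _ _ [x _ <-] [y _ <-]; exists (a *: x + y); rewrite ?lT.
Qed.

(** T is a bijection of its range onto itself, so X y can be taken as the w in R(T) for which T w is
    the component of y in R(T) along N(T). *)
Lemma group_inverse_exists T : split_op T ->
  exists X, [/\ bounded_op X, T \o X \o T = T, X \o T \o X = X & T \o X = X \o T].
Proof.
move=> [bT cR dec disj]; have [lT _] := bT.
have sR := range_closed_subspace lT cR; have sK := ker_closed_subspace bT.
have ker0 x : range T x -> ker T x -> x = 0.
  by move=> Rx Kx; have : (range T `&` ker T) x by []; rewrite disj.
have TR x : range T (T x) by exists x.
have /choice[X hX] y : exists w, range T w /\ ker T (y - T w).
  (* Decompose y = T x + v, then x = u + n: since T n = 0, u has the same image as x and lies in the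
     range. *)
  have [_ [v [[x _ <-] Kv ->]]] := dec y.
  have [u [n [Ru Kn ->]]] := dec x.
  exists u; split=> //; rewrite (linD _ _ lT) (Kn : T n = 0) addr0.
  by rewrite addrAC subrr add0r.
have uniq y w : range T w -> ker T (y - T w) -> X y = w.
  move=> Rw Kw; have [RX KX] := hX y.
  have Rd : range T (X y - w) by exact: subspaceB.
  (* R(T) and N(T) meet only in 0. This is used twice: first for d = X y - w, then for T d to see
     that d is in N(T). *)
  apply/eqP; rewrite -subr_eq0; apply/eqP; apply: (ker0) => //.
  apply: (ker0); first exact: TR.
  have -> : T (X y - w) = (y - T w) - (y - T (X y)).
    by rewrite [- (y - T (X y))]opprB [RHS]addrC subrKA linB.
  exact: subspaceB.
have lX : linear X.
  move=> a x y; have [Rx Kx] := hX x; have [Ry Ky] := hX y.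
  apply: uniq; first by case: sR => _ _; apply.
  rewrite lT opprD addrACA -scalerBr; case: sK => _ _; exact.
have bX : bounded_op X.
  apply: closed_graph => // x y hxy.
  have [_ [M M0 hM]] := bounded_opP bT.
  apply: uniq.
    apply: (closed_nrm cR) => e e0; have [x' [_ hx']] := hxy e e0.
    by exists (X x') => //; case: (hX x').
  apply: closed_nrm => [|e e0]; first by case: sK.
  (* Both coordinates of the graph are approximated to e / (1 + M), so that the error in x plus M
     times the error in y stays below e. *)
  have [|x' [h1 h2]] := hxy (e / (1 + M)).
    by rewrite divr_gt0 // addr_gt0.
  exists (x' - T (X x')); first by case: (hX x').
  have -> : x - T y - (x' - T (X x')) = (x - x') - T (y - X x').
    by rewrite (linB _ _ lT) !opprD addrACA.
  apply: le_lt_trans (nrmD _ _) _; rewrite nrmN.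
  have := hM (y - X x') => h3.
  have h4 : M * nrm (y - X x') < M * (e / (1 + M)) by rewrite ltr_pM2l.
  have -> : e = e / (1 + M) + M * (e / (1 + M)).
    by field; rewrite gt_eqF // addr_gt0.
  lra.
have XT y : X (T y) = T (X y).
  apply: uniq; first exact: TR.
  have [_ Ky] := hX y; rewrite -(linB _ _ lT).
  by rewrite (Ky : T (y - T (X y)) = 0) /ker /= lin0.
exists X; split=> //.
- apply/funext => y /=; have [_ Ky] := hX y.
  move: (Ky : T (y - T (X y)) = 0); rewrite (linB _ _ lT) => /eqP.
  by rewrite subr_eq0 XT => /eqP <-.
- apply/funext => y /=; apply: uniq; first by case: (hX y).
  by rewrite subrr; case: sK.
- by apply/funext => y /=; rewrite XT.
Qed.

Lemma group_inverseP T : split_op T ->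
  [/\ bounded_op (group_inverse T), forall x, T (group_inverse T (T x)) = T x,
      forall x, group_inverse T (T (group_inverse T x)) = group_inverse T x &
      forall x, T (group_inverse T x) = group_inverse T (T x)].
Proof.
move=> hT; have [Y hY] := group_inverse_exists hT.
have [bX h1 h2 h3] : [/\ bounded_op (group_inverse T),
    T \o group_inverse T \o T = T,
    group_inverse T \o T \o group_inverse T = group_inverse T &
    T \o group_inverse T = group_inverse T \o T].
  exact: (xgetI 0 (P := [set X | [/\ bounded_op X, T \o X \o T = T,
    X \o T \o X = X & T \o X = X \o T]]) hY).
split=> // x; first exact: (congr1 (@^~ x) h1).
  exact: (congr1 (@^~ x) h2).
exact: (congr1 (@^~ x) h3).
Qed.

Lemma inner_inj x y : (forall z, inner x z = inner y z) -> x = y.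
Proof.
move=> h; apply/eqP; rewrite -subr_eq0; apply/eqP/inner_eq0.
by rewrite innerBl h subrr.
Qed.

(** For another such inverse Y, taking adjoints in TX = (TY)(TX) gives TX = (TX)(TY) = TY; likewise
    XT = YT. Then Y = YTY = XTX = X. *)
Lemma mp_inverse_unique T X : bounded_op T -> bounded_op X ->
  (forall x, T (X (T x)) = T x) -> (forall x, X (T (X x)) = X x) ->
  symmetric_op (T \o X) -> symmetric_op (X \o T) -> mp_inverse T = X.
Proof.
move=> bT bX TXT XTX sTX sXT; apply: xget_unique.
  split=> //; try by apply/funext => x /=.
    by apply/hermitianP => //; exact: bounded_op_comp.
  by apply/hermitianP => //; exact: bounded_op_comp.
move=> Y [bY TYT YTY hTY hYT].
have sTY : symmetric_op (T \o Y) by apply/hermitianP => //; exact: bounded_op_comp.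
have sYT : symmetric_op (Y \o T) by apply/hermitianP => //; exact: bounded_op_comp.
have TYT' x : T (Y (T x)) = T x by exact: (congr1 (@^~ x) TYT).
have YTY' x : Y (T (Y x)) = Y x by exact: (congr1 (@^~ x) YTY).
have h1 x : T (X x) = T (Y x).
  apply: inner_inj => z; rewrite -[T (X x)]TYT'.
  by rewrite (sTY (T (X x)) z) (sTX x (T (Y z))) /= TXT -(sTY x z).
have h2 x : X (T x) = Y (T x).
  apply: inner_inj => z; rewrite -[T x in LHS]TYT'.
  by rewrite (sXT (Y (T x)) z) /= (sYT x (X (T z))) /= TXT -(sYT x z).
by apply/funext => x; rewrite -YTY' -h1 -h2 XTX.
Qed.

End Inverses.

(** * The group proper splitting and its iteration operator *)

Section Splitting.
Context {R : realType} {H : hilbertType R}.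
Implicit Types (x y z : H) (S T U X Y P : H -> H) (A : set H).

Lemma perp_closed_subspace A : closed_subspace A -> closed_subspace (perp A).
Proof.
move=> sA; have [bP PA Pid Pperp _] := orth_projP sA.
rewrite (_ : perp A = ker (orth_proj A)); first exact: ker_closed_subspace.
apply/seteqP; split=> x /= hx.
  apply: (@perp0 _ _ A) => //.
  rewrite -[orth_proj A x](subKr x); exact: perpB.
by rewrite -[x]subr0 -[X in _ - X](hx : orth_proj A x = 0); exact: Pperp.
Qed.

(** Together the two claims express that the projection onto the complement of A is the identity
    minus the projection onto A. *)
Lemma orth_proj_perp A x : closed_subspace A ->
  (A x -> orth_proj (perp A) x = 0) /\ A (x - orth_proj (perp A) x).
Proof.
move=> sA; have [_ PA _ Pperp sP] := orth_projP (perp_closed_subspace sA).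
have P0 y : A y -> orth_proj (perp A) y = 0.
  by move=> Ay; apply: inner_eq0; rewrite sP; apply: PA.
split; first exact: P0.
have [p Ap hp] := projection_theorem x sA.
have [[lP _] _ Pid _ _] := orth_projP (perp_closed_subspace sA).
have -> : orth_proj (perp A) x = x - p.
  by rewrite -(Pid _ hp) (linB _ _ lP) (P0 _ Ap) subr0.
by rewrite subKr.
Qed.

(* If z is orthogonal to ker T and X is the group inverse of T, then 1 - XT
   maps into ker T, so z = (XT)^* z = T^* (X^* z). *)
Lemma range_adjoint T : split_op T -> range (adjoint T) = perp (ker T).
Proof.
move=> hT; have [bT _ _ _] := hT; have [lT _] := bT.
have [bX TXT _ TX] := group_inverseP hT.
have [_ hTa] := adjointP bT; have [_ hXa] := adjointP bX.
apply/seteqP; split=> [_ [y _ <-] x Kx|z hz].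
  by rewrite -hTa (Kx : T x = 0) inner0l.
exists (adjoint (group_inverse T) z) => //.
apply/eqP; rewrite -subr_eq0; apply/eqP/inner_eq0.
set u := _ - z; rewrite {2}/u innerBr -hTa -hXa -innerBl -TX.
have -> : T (group_inverse T u) - u = - (u - group_inverse T (T u)).
  by rewrite [RHS]opprB TX.
rewrite innerNl hz ?oppr0 //.
by rewrite /ker /= (linB _ _ lT) TXT subrr.
Qed.

(** With P and Q the projections onto the complement of N(T) and onto R(T), the candidate Y = PTQ
    satisfies XY = Q and YX = P. These are symmetric, and the Penrose equations follow. *)
Lemma mp_inverse_group_inverse T : split_op T ->
  mp_inverse (group_inverse T) =
  orth_proj (perp (ker T)) \o T \o orth_proj (range T).
Proof.
move=> hT; have [bT cR _ _] := hT; have [lT _] := bT.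
have [bX TXT XTX TX] := group_inverseP hT.
move: (group_inverse T) bX TXT XTX TX => X bX TXT XTX TX; have [lX _] := bX.
have sK := ker_closed_subspace bT; have sN := perp_closed_subspace sK.
have sR := range_closed_subspace lT cR.
have [bP PN Pid _ sP] := orth_projP sN; have [bQ QR Qid _ sQ] := orth_projP sR.
have hP x := orth_proj_perp x sK.
move: (orth_proj (perp _)) bP PN Pid sP hP => P bP PN Pid sP hP.
move: (orth_proj (range T)) bQ QR Qid sQ => Q bQ QR Qid sQ.
have [lP _] := bP.
have X0 x : ker T x -> X x = 0.
  by move=> Kx; rewrite -XTX TX (Kx : T x = 0) !(lin0 lX).
have XP x : X (P x) = X x.
  have [_ /X0] := hP x; rewrite (linB _ _ lX) => /eqP.
  by rewrite subr_eq0 => /eqP.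
have PX x : P (T (X x)) = P x.
  (* x - T X x lies in N(T), which P annihilates. *)
  have [h _] := hP (x - T (X x)).
  have : P (x - T (X x)) = 0.
    by apply: h; rewrite /ker /= (linB _ _ lT) TX TXT subrr.
  by rewrite (linB _ _ lP) => /eqP; rewrite subr_eq0 => /eqP.
have RX x : range T (X x) by exists (X (X x)) => //; rewrite TX XTX.
have XY x : X (P (T (Q x))) = Q x.
  by rewrite XP; have [u _ <-] := QR x; rewrite -TX TXT.
have YX x : P (T (Q (X x))) = P x by rewrite Qid.
apply: mp_inverse_unique => //=.
- by do 2![apply: bounded_op_comp => //].
- by move=> x; rewrite XY Qid.
- by move=> x; rewrite YX Pid.
- by move=> x y /=; rewrite !XY.
- by move=> x y /=; rewrite !YX.
Qed.

Lemma iteration_operator T : split_op T ->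
  mp_inverse (group_inverse T) \o (group_inverse T \- T) =
  orth_proj (perp (ker T)) \o (idfun \- (T \o T)).
Proof.
move=> hT; rewrite mp_inverse_group_inverse //.
have [bT cR _ _] := hT; have [lT _] := bT.
have [_ TXT XTX TX] := group_inverseP hT.
have sK := ker_closed_subspace bT; have sN := perp_closed_subspace sK.
have [_ _ Qid _ _] := orth_projP (range_closed_subspace lT cR).
have [[lP _] _ _ _ _] := orth_projP sN.
apply/funext => x /=; rewrite Qid; last first.
  (* X = T X X, so (X - T) x = T (X X x - x) lies in R(T), where the projection onto R(T) is the
     identity. *)
  exists (group_inverse T (group_inverse T x) - x) => //.
  by rewrite (linB _ _ lT) TX XTX.
rewrite (linB _ _ lT) !(linB _ _ lP); congr (_ - _).
(* What remains is P T X = P: the difference T X x - x is in N(T). *)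
apply/eqP; rewrite -subr_eq0 -(linB _ _ lP); apply/eqP.
have [h _] := orth_proj_perp (T (group_inverse T x) - x) sK; apply: h.
by rewrite /ker /= (linB _ _ lT) TX TXT subrr.
Qed.

Lemma group_proper_splitting T : split_op T ->
  proper_splitting T (group_inverse T) (group_inverse T \- T).
Proof.
move=> hT; have [bT _ _ _] := hT; have [lT _] := bT.
have [bX TXT XTX TX] := group_inverseP hT.
have [lX _] := bX; split=> //.
- exact: bounded_opB.
- by apply/funext => x /=; rewrite subKr.
- apply/seteqP; split=> _ [x _ <-].
    by exists (group_inverse T (group_inverse T x)) => //; rewrite TX XTX.
  by exists (T (T x)) => //; rewrite -TX TXT.
- apply/seteqP; split=> x; rewrite /ker /= => h.
    by rewrite -TXT -TX h !(lin0 lT).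
  by rewrite -XTX TX h !(lin0 lX).
Qed.

End Splitting.

(** * The two implications *)

Theorem proposition5p4 (R : realType) (H : hilbertType R) (T : H -> H)
    (hT : split_op T) :
  (opnorm (orth_proj (range (adjoint T)) \o (idfun \- (T \o T))) < 1 ->
     group_splitting_converges T) /\
  (hermitian_op (orth_proj (range (adjoint T)) \o (T \o T)) ->
     group_splitting_converges T ->
     opnorm (orth_proj (range (adjoint T)) \o (idfun \- (T \o T))) < 1).
Proof.
rewrite /group_splitting_converges /converges range_adjoint // iteration_operator //.
have [bT _ _ _] := hT.
have sN := perp_closed_subspace (ker_closed_subspace bT).
have [bP _ _ _ sP] := orth_projP sN; have [lP _] := bP.
have bTT : bounded_op (T \o T) by exact: bounded_op_comp.
have bS : bounded_op (orth_proj (perp (ker T)) \o (idfun \- (T \o T))).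
  apply: bounded_op_comp => //; apply: bounded_opB => //; exact: bounded_op_id.
split=> [h|/hermitianP h [_ r1]].
  split; first exact: group_proper_splitting.
  exact: le_lt_trans (spectral_radius_le_opnorm bS) h.
apply: le_lt_trans r1; apply: symmetric_opnorm => // x y /=.
have {}h : symmetric_op (orth_proj (perp (ker T)) \o (T \o T)).
  by apply: h; exact: bounded_op_comp.
(* S = P - P T^2 is a difference of two symmetric operators. *)
by rewrite !(linB _ _ lP) innerBl innerBr sP (h x y).
Qed.
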